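(* For all integers $n,m,k\geq 0$, \[ A_{n+m+k,m+k}(\mathbf{t})=\sum_{j=0}^{m}\binom{m}{j}t_1^{m-j}A_{n+k+j,k}(\mathbf{t}). \]
   Context: $t_1,t_2,\dots$ are indeterminates. For a set partition $\pi$ assign each block of size $j$ the weight $t_j$, and let $w(\pi)$ be the product of its block weights. For $0\le k\le n$, $A_{n,k}(\mathbf{t})$ is the sum of $w(\pi)$ over all partitions of $[n+1]=\{1,\dots,n+1\}$ whose largest singleton block is $\{k+1\}$ (i.e. $\{k+1\}$ is a block and no $\{i\}$ with $i>k+1$ is a block). *)

(* Defs.v *)
From mathcomp Require Import all_boot all_order all_algebra.
From mathcomp Require Import finmap.
From mathcomp Require Import monalg.

Set Implicit Arguments.
Unset Strict Implicit.
Unset Printing Implicit Defensive.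

Import GRing.Theory.
Local Open Scope ring_scope.

(* Z[t_0, t_1, t_2, ...]; blocks are nonempty, so t_0 never occurs in the
   polynomials below. *)
Definition Zt : comNzRingType := {malg int[{cmonom nat}]}.

Definition tvar (j : nat) : Zt := << ucm j >>.

(* The ordinal i : 'I_N stands for the element i + 1 of [N] = {1, ..., N}. *)
Definition partition_weight (R : comNzRingType) (t : nat -> R) (N : nat)
    (P : {set {set 'I_N}}) : R :=
  \prod_(B in P) t #|B|.

Definition largest_singleton (N : nat) (P : {set {set 'I_N}}) (i : 'I_N) : bool :=
  ([set i] \in P) && [forall j : 'I_N, (i < j)%N ==> ([set j] \notin P)].

(* The paper's A_{n,k}(t), meaningful for k <= n (it is 0 for k > n); the
   element k + 1 of [n + 1] is the ordinal of value k. *)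
Definition A (R : comNzRingType) (t : nat -> R) (n k : nat) : R :=
  \sum_(P : {set {set 'I_n.+1}} |
        partition P [set: 'I_n.+1] &&
        [exists i : 'I_n.+1, (val i == k) && largest_singleton P i])
    partition_weight t P.

(* Main.v *)
Require Import Defs.
From mathcomp Require Import all_boot all_order all_algebra.
From mathcomp Require Import perm monalg.

Import GRing.Theory.
Local Open Scope ring_scope.

(** Deleting the block {k+1} shows that A_{n,k} is t_1 times the sum of the
    weights of the partitions of an n-set in which n - k prescribed elements are
    not singleton blocks.  Such a sum depends only on the two cardinalities, so
    splitting according to whether one further element is a singleton gives
    A_{n+1,k+1} = A_{n+1,k} + t_1 A_{n,k}, and the theorem is the m-fold iterate
    of this recurrence. *)

(** The ground set [D] is a subset of [T], so that an element can be deleted without changing the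
    type. *)
Definition nosing_sum (R : comNzRingType) (t : nat -> R) (T : finType)
    (D S : {set T}) : R :=
  \sum_(P : {set {set T}} |
        partition P D && [forall x in S, [set x] \notin P])
     \prod_(B in P) t #|B|.

(** Removing the block [[set i]], of weight [t 1], is a bijection onto the partitions of [D :\ i];
    as [i] lies outside [S], the condition on [S] is unaffected. *)
Lemma singleton_block_sum (R : comNzRingType) (t : nat -> R) (T : finType)
    (D S : {set T}) (i : T) :
  i \in D -> i \notin S ->
  \sum_(P : {set {set T}} |
        partition P D && [forall x in S, [set x] \notin P] && ([set i] \in P))
     \prod_(B in P) t #|B|
  = t 1%N * nosing_sum R t T (D :\ i) S.
Proof.
move=> iD iS; rewrite /nosing_sum big_distrr /=.
rewrite (reindex_onto (fun Q => [set i] |: Q) (fun P => P :\ [set i])) /=; last first.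
  by move=> P /andP[_ iP]; rewrite setD1K.
(* This makes the round-trip condition of the reindexing automatic. *)
have iQ Q : partition Q (D :\ i) -> [set i] \notin Q.
  by move=> pQ; apply/negP => /(partitionS pQ); rewrite sub1set !inE eqxx.
have avoidU Q : [forall x in S, [set x] \notin [set i] |: Q]
    = [forall x in S, [set x] \notin Q].
  apply: eq_forallb => x; case xS: (x \in S) => //=.
  by rewrite !inE (inj_eq set1_inj) (negbTE (memPn iS x xS)).
apply: eq_big => [Q|Q /andP[_ /eqP QE]]; last first.
  by rewrite big_setU1 ?cards1 // -QE setD11.
rewrite avoidU setU11 andbT -andbA [_ && (_ == _)]andbC andbA.
congr (_ && _); apply/andP/idP => [[pD /eqP <-]|pQ].
  by have := partitionD1 pD (setU11 _ _).
rewrite setU1K ?iQ // eqxx; split=> //.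
rewrite -(setD1K iD); apply: partitionU1 => //.
  by apply/set0Pn; exists i; rewrite inE.
by rewrite disjoints1 !inE eqxx.
Qed.

Lemma nosing_sumU1 (R : comNzRingType) (t : nat -> R) (T : finType)
    (D S : {set T}) (i : T) :
  i \in D -> i \notin S ->
  nosing_sum R t T D S
  = nosing_sum R t T D (i |: S) + t 1%N * nosing_sum R t T (D :\ i) S.
Proof.
move=> iD iS; rewrite -(singleton_block_sum R t T D S i iD iS) {1}/nosing_sum.
rewrite (bigID (fun P : {set {set T}} => [set i] \in P)) /= addrC; congr (_ + _).
apply: eq_bigl => P; rewrite -andbA; congr (_ && _).
apply/andP/forall_inP => [[/forall_inP aP iP] x|aP].
  by rewrite !inE => /predU1P[->|/aP].
by split; [apply/forall_inP => x xS|]; apply: aP; rewrite !inE ?eqxx ?xS ?orbT.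
Qed.

(** An injection carries partitions over block by block, preserving block sizes and singletons. This
    replaces the appeal to cardinalities: only explicit injections are needed. *)
Lemma nosing_sum_imset (R : comNzRingType) (t : nat -> R) (T T' : finType)
    (f : T -> T') (D S : {set T}) :
  injective f ->
  nosing_sum R t T' (f @: D) (f @: S) = nosing_sum R t T D S.
Proof.
move=> inj_f; rewrite {1}/nosing_sum.
have inj_F : injective (fun B : {set T} => f @: B) by exact: imset_inj.
rewrite (reindex_onto (fun P : {set {set T}} => [set f @: (B : {set T}) | B in P])
          (fun Q : {set {set T'}} => [set f @^-1: (B : {set T'}) | B in Q])) /=; last first.
  (* Blocks of [Q] lie in the image of [D], so taking preimages and then images restores them. *)
  move=> Q /andP[pQ _]; rewrite -imset_comp -[RHS]imset_id.
  apply: eq_in_imset => B BQ /=; apply/setP => y.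
  apply/imsetP/idP => [[x] /[!inE] xB -> // | yB].
  have /imsetP[x _ yE] := subsetP (partitionS pQ BQ) y yB.
  by exists x => //; rewrite inE -yE.
apply: eq_big => [P|P _].
  rewrite imset_partition // -andbA; congr (_ && _).
  have -> : [set f @^-1: (B : {set T'}) | B in [set f @: (B : {set T}) | B in P]] = P.
    rewrite -imset_comp -[RHS]imset_id; apply: eq_in_imset => B _ /=.
    by apply/setP => x; rewrite inE mem_imset.
  rewrite eqxx andbT; apply/forall_inP/forall_inP => aP x.
    by move=> xS; have := aP (f x) (imset_f f xS); rewrite -imset_set1 mem_imset.
  by case/imsetP => z zS ->; rewrite -imset_set1 mem_imset ?aP.
rewrite big_imset /=; last by move=> B C _ _ /inj_F.
by apply: eq_bigr => B _; rewrite card_imset.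
Qed.

Lemma A_nosing_sum (R : comNzRingType) (t : nat -> R) (n : nat) (i : 'I_n.+1) :
  A t n i
  = t 1%N * nosing_sum R t 'I_n.+1 ([set: 'I_n.+1] :\ i) [set j : 'I_n.+1 | (i < j)%N].
Proof.
rewrite -singleton_block_sum ?inE ?ltnn //.
apply: eq_bigl => P; rewrite -andbA; congr (_ && _).
have -> : [exists j : 'I_n.+1, (val j == i) && largest_singleton P j]
    = largest_singleton P i.
  apply/existsP/idP => [[j /andP[/eqP/val_inj -> //]]|lP].
  by exists i; rewrite eqxx.
rewrite /largest_singleton andbC; congr (_ && _).
by apply: eq_forallb => j; rewrite inE.
Qed.

Lemma A_rec (R : comNzRingType) (t : nat -> R) (n k : nat) :
  (k <= n)%N -> A t n.+1 k.+1 = A t n.+1 k + t 1%N * A t n k.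
Proof.
move=> le_kn.
have lt1 : (k.+1 < n.+2)%N by [].
have lt0 : (k < n.+2)%N by rewrite ltnS leqW.
have lt0' : (k < n.+1)%N by [].
pose a := Ordinal lt0; pose b := Ordinal lt1; pose c := Ordinal lt0'.
have aNb : a != b by rewrite -val_eqE /= neq_ltn ltnSn.
have Eb := A_nosing_sum R t n.+1 b; have Ea := A_nosing_sum R t n.+1 a.
have Ec := A_nosing_sum R t n c; rewrite /= in Ea Eb Ec.
rewrite Ea Eb Ec -mulrDr; congr (_ * _).
(* With [b] deleted, split on whether [a], its predecessor, is a singleton. *)
rewrite (nosing_sumU1 R t _ _ _ a) ?inE ?aNb //= ?ltnNge ?leqnSn //.
congr (_ + t 1%N * _).
  (* Swapping [a] and [b] fixes everything above [b], hence sends the elements above [a] to [a] and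
     the elements above [b]. *)
  rewrite -[RHS](nosing_sum_imset R t _ _ (tperm a b)); last exact: perm_inj.
  congr nosing_sum; apply/setP => x.
    rewrite -{2}[x](tpermK a b) mem_imset; last exact: perm_inj.
    rewrite !inE !andbT; congr (~~ _).
    by rewrite -{2}[a](tpermR a b) (inj_eq (@perm_inj _ _)).
  rewrite -{2}[x](tpermK a b) mem_imset; last exact: perm_inj.
  rewrite !inE; case: tpermP => [->|->|/eqP xa /eqP xb].
  - by rewrite /= eqxx ltnSn.
  - by rewrite /= eq_sym (negbTE aNb) !ltnn.
  - move: xa xb; rewrite -!val_eqE /= => /negbTE -> xb.
    by rewrite ltn_neqAle eq_sym xb.
(* [lift a] skips the value [k]: it sends [c] to [b], and the elements above [c] to those above
   [b]. *)
rewrite -(nosing_sum_imset R t _ _ (lift a)); last exact: lift_inj.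
have bE : b = lift a c by apply: val_inj; rewrite /= /bump leqnn.
congr nosing_sum; apply/setP => x; case: (unliftP a x) => [y|] ->.
- by rewrite mem_imset ?bE ?(inj_eq lift_inj) ?inE ?(inj_eq lift_inj) //;
    [rewrite eq_sym neq_lift | exact: lift_inj].
- rewrite !inE eqxx; apply/esym/imsetP => -[y _ /eqP]; apply/negP; exact: neq_lift.
- rewrite mem_imset ?inE; last exact: lift_inj.
  rewrite /= /bump; case: (leqP k y) => [_|/ltnW le_yk]; first by rewrite add1n.
  by rewrite !ltnNge le_yk (leqW le_yk).
- rewrite !inE ltnNge leqnSn; apply/esym/imsetP => -[y _ /eqP]; apply/negP; exact: neq_lift.
Qed.

Lemma A_shift (R : comNzRingType) (t : nat -> R) (n m k : nat) :
  A t (n + m + k) (m + k) =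
  \sum_(0 <= j < m.+1)
     'C(m, j)%:R * t 1%N ^+ (m - j) * A t (n + k + j) k.
Proof.
(* [n] stays general because the recurrence calls the induction hypothesis at both [n.+1] and
   [n]. *)
elim: m n => [|m IH] n.
  by rewrite big_nat1 bin0 subn0 expr0 !mul1r !addn0.
rewrite addnS !addSn A_rec; last by rewrite leq_add2r leq_addl.
rewrite -!addSn !IH [RHS]big_nat_recl //=.
(* By Pascal's rule, the ['C(m, j)] part is the hypothesis at [n.+1]; the rest, with the term
   [j = 0], is [t 1] times the hypothesis at [n]. *)
under [in RHS]eq_bigr => j _ do rewrite binS natrD mulrDl mulrDl addnS -!addSn subSS.
rewrite big_split /= addrA [RHS]addrC; congr (_ + _).
pose F j := 'C(m, j)%:R * t 1%N ^+ (m.+1 - j) * A t (n + k + j) k.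
transitivity (\sum_(0 <= j < m.+2) F j); last first.
  rewrite [LHS]big_nat_recl // /F !bin0; congr (_ + _).
  by apply: eq_bigr => j _; rewrite subSS addnS -!addSn.
(* The extra top term vanishes since ['C(m, m.+1)] is zero. *)
rewrite [RHS]big_nat_recr //= [F m.+1]/F bin_small // !mul0r addr0 big_distrr /=.
apply: eq_big_nat => j /andP[_ lt_jm].
by rewrite /F subSn // exprS !mulrA [t 1%N * _]mulrC.
Qed.

Theorem theorem2p5 (n m k : nat) :
  A tvar (n + m + k) (m + k) =
  \sum_(0 <= j < m.+1)
     'C(m, j)%:R * tvar 1 ^+ (m - j) * A tvar (n + k + j) k.
Proof. exact: A_shift. Qed.
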